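(* Let $(M,g)$ be the Hayward black hole spacetime with parameters $m>0$, $b>0$: coordinates $(t,r,\theta,\phi)$ and $g=-\frac{B}{B_1}dt^2+\frac{B_1}{B}dr^2+r^2(d\theta^2+\sin^2\theta\, d\phi^2)$, where $B=2b^2m+r^2(r-2m)$, $B_1=2b^2m+r^3$, on the domain $r>0$, $0<\theta<\pi$, $B\neq 0$. Put $B_2=4b^2m-r^3$. Then $M$ is not Ricci generalized pseudosymmetric (there is no smooth function $L$ on $\{x\in M: Q(S,R)\neq0 \text{ at } x\}$ with $R\cdot R=L\,Q(S,R)$ there), but it is pseudosymmetric and satisfies: (i) $R\cdot R=-\frac{mB_2}{B_1^2}Q(g,R)$, and hence $R\cdot C=-\frac{mB_2}{B_1^2}Q(g,C)$; (ii) $C\cdot R=-\frac{mr^3B_2}{B_1^3}Q(g,R)$, and hence $C\cdot C=-\frac{mr^3B_2}{B_1^3}Q(g,C)$; (iii) $R\cdot R-\frac{m(16b^2m-r^3)}{B_2B_1}Q(g,C)=Q(S,R)$, at points where $B_2\neq0$; (iv) $C\cdot R-R\cdot C=\mathcal L_1Q(g,R)+\mathcal L_2Q(S,R)$ with $\mathcal L_1=-\frac{8b^2m^2B_2}{(16b^2m-r^3)B_1^2}$ and $\mathcal L_2=\frac{16b^4m^2-8b^2mr^3+r^6}{(r^3-16b^2m)B_1}$, at points where $r^3\neq16b^2m$; (v) $C\cdot R-R\cdot C=\mathcal L_3Q(g,C)+\mathcal L_4Q(S,C)$ with $\mathcal L_3=\frac{8b^2m^2B_2}{B_1^3}$ and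 $\mathcal L_4=1$.
   Context: Conventions ($n=\dim M=4$). Sign of curvature: $R_{pq\mu\nu}=g_{p\alpha}(\partial_\mu\Gamma^\alpha_{q\nu}-\partial_\nu\Gamma^\alpha_{q\mu}+\Gamma^\beta_{q\nu}\Gamma^\alpha_{\beta\mu}-\Gamma^\beta_{q\mu}\Gamma^\alpha_{\beta\nu})$; Ricci tensor $S_{q\mu}=g^{p\nu}R_{pq\mu\nu}$; scalar curvature $\kappa=g^{q\mu}S_{q\mu}$. (With this convention, for the present metric $R_{3434}=\frac{2mr^4\sin^2\theta}{B_1}$, $S_{33}=-\frac{12b^2m^2r^2}{B_1^2}$.) Kulkarni–Nomizu product: $(A\wedge U)_{pq\mu\nu}=A_{p\nu}U_{q\mu}-A_{p\mu}U_{q\nu}+A_{q\mu}U_{p\nu}-A_{q\nu}U_{p\mu}$. Conformal curvature tensor: $C=R-\frac1{n-2}g\wedge S+\frac{\kappa}{2(n-1)(n-2)}g\wedge g$. For a $(0,4)$-tensor $T$ and a $(0,k)$-tensor $H$: $(T\cdot H)_{q_1\cdots q_k\nu\mu}=-g^{pr}[T_{\mu\nu q_1r}H_{pq_2\cdots q_k}+\cdots+T_{\mu\nu q_kr}H_{q_1\cdots q_{k-1}p}]$. For a symmetric $(0,2)$-tensor $Z$: $Q(Z,H)_{q_1\cdots q_k\nu\mu}=Z_{\mu q_1}H_{\nu q_2\cdots q_k}+\cdots+Z_{\mu q_k}H_{q_1\cdots q_{k-1}\nu}-Z_{\nu q_1}H_{\mu q_2\cdots q_k}-\cdots-Z_{\nu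 q_k}H_{q_1\cdots q_{k-1}\mu}$. $M$ is pseudosymmetric (Deszcz) if $R\cdot R=L\,Q(g,R)$ for a smooth function $L$ on the set where $Q(g,R)\neq0$. *)

(* Defs.v *)
From mathcomp Require Import all_boot all_order all_algebra.
From mathcomp Require Import all_classical all_reals all_analysis.

Set Implicit Arguments.
Unset Strict Implicit.
Unset Printing Implicit Defensive.

Import Order.TTheory GRing.Theory Num.Theory.
Import numFieldNormedType.Exports.

Local Open Scope classical_set_scope.
Local Open Scope ring_scope.

Section Smooth.
Variables (R : realType) (n : nat).
Implicit Types (U : set 'rV[R]_n) (f : 'rV[R]_n -> R).

Definition partial (i : 'I_n) f (x : 'rV[R]_n) : R := 'D_(delta_mx 0 i) f x.

(* Meant for open U: the values of f outside U are then irrelevant. *)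
Fixpoint Ck_on (k : nat) U f : Prop :=
  (forall x, U x -> {for x, continuous f}) /\
  match k with
  | 0 => True
  | k'.+1 => forall i, (forall x, U x -> derivable f x (delta_mx 0 i)) /\
                       Ck_on k' U (partial i f)
  end.

Definition smooth_on U f : Prop := forall k, Ck_on k U f.

End Smooth.

Section PointwiseTensors.
Variables (R : realType) (n : nat).

(* Components of a (0,k)-tensor at a point. (0,2)-tensors whose components
   enter linear algebra (the metric, the Ricci tensor) are n x n matrices. *)
Definition tensor (k : nat) : Type := k.-tuple 'I_n -> R.

Definition tensor4 (F : 'I_n -> 'I_n -> 'I_n -> 'I_n -> R) : tensor 4 :=
  fun q => F [tnth q 0] [tnth q 1] [tnth q 2] [tnth q 3].

Definition subst_index k (q : k.-tuple 'I_n) (i : 'I_k) (p : 'I_n) :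
  k.-tuple 'I_n := [tuple if j == i then p else tnth q j | j < k].

(* A (0,k+2)-tensor from an expression in (q_1, ..., q_k), nu, mu. *)
Definition tensorD2 k (F : k.-tuple 'I_n -> 'I_n -> 'I_n -> R) :
    tensor (k + 2) :=
  fun q => F [tuple tnth q (lshift 2 i) | i < k]
             (tnth q (rshift k ord0)) (tnth q (rshift k ord_max)).

(* (A /\ U)_{p q mu nu} *)
Definition kulkarni_nomizu (A U : 'M[R]_n) : tensor 4 :=
  tensor4 (fun p q mu nu =>
    A p nu * U q mu - A p mu * U q nu + A q mu * U p nu - A q nu * U p mu).

(* (T . H)_{q_1 ... q_k nu mu}, with respect to the metric g *)
Definition tdot (g : 'M[R]_n) k (T : tensor 4) (H : tensor k) :
    tensor (k + 2) :=
  tensorD2 (fun q nu mu =>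
    - \sum_p \sum_r invmx g p r *
        \sum_(i < k) T [tuple mu; nu; tnth q i; r] * H (subst_index q i p)).

(* Q(Z, H)_{q_1 ... q_k nu mu} *)
Definition tachibana (Z : 'M[R]_n) k (H : tensor k) : tensor (k + 2) :=
  tensorD2 (fun q nu mu =>
    \sum_(i < k) Z mu (tnth q i) * H (subst_index q i nu) -
    \sum_(i < k) Z nu (tnth q i) * H (subst_index q i mu)).

Definition tensor_neq0 k (H : tensor k) : Prop := exists q, H q != 0.

End PointwiseTensors.

Section Curvature.
Variables (R : realType) (n : nat).

(* The metric components as functions of the coordinates. *)
Implicit Type g : 'rV[R]_n -> 'M[R]_n.

(* Gamma^a_{q nu} *)
Definition christoffel g (a q nu : 'I_n) (x : 'rV[R]_n) : R :=
  2^-1 * \sum_e invmx (g x) a e *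
    (partial q (fun y => g y e nu) x + partial nu (fun y => g y e q) x
     - partial e (fun y => g y q nu) x).

(* R_{p q mu nu} *)
Definition riemann g (x : 'rV[R]_n) : tensor R n 4 :=
  let Gam := christoffel g in
  tensor4 (fun p q mu nu =>
    \sum_a g x p a *
      (partial mu (Gam a q nu) x - partial nu (Gam a q mu) x
       + \sum_e (Gam e q nu x * Gam a e mu x - Gam e q mu x * Gam a e nu x))).

Definition ricci g (x : 'rV[R]_n) : 'M[R]_n :=
  \matrix_(q, mu) \sum_p \sum_nu
    invmx (g x) p nu * riemann g x [tuple p; q; mu; nu].

Definition scalar_curvature g (x : 'rV[R]_n) : R :=
  \sum_q \sum_mu invmx (g x) q mu * ricci g x q mu.

Definition weyl g (x : 'rV[R]_n) : tensor R n 4 := fun q =>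
  riemann g x q
  - (n%:R - 2)^-1 * kulkarni_nomizu (g x) (ricci g x) q
  + scalar_curvature g x / (2 * (n%:R - 1) * (n%:R - 2))
    * kulkarni_nomizu (g x) (g x) q.

(* U is the open set of coordinates on which the metric g is considered. *)
Definition pseudosymmetric (U : set 'rV[R]_n) g : Prop :=
  let V := [set x | U x /\ tensor_neq0 (tachibana (g x) (riemann g x))] in
  exists2 L : 'rV[R]_n -> R, smooth_on V L &
    forall x, V x -> forall q,
      tdot (g x) (riemann g x) (riemann g x) q
      = L x * tachibana (g x) (riemann g x) q.

Definition ricci_generalized_pseudosymmetric (U : set 'rV[R]_n) g : Prop :=
  let V := [set x | U x /\ tensor_neq0 (tachibana (ricci g x) (riemann g x))] in
  exists2 L : 'rV[R]_n -> R, smooth_on V L &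
    forall x, V x -> forall q,
      tdot (g x) (riemann g x) (riemann g x) q
      = L x * tachibana (ricci g x) (riemann g x) q.

End Curvature.

Section Hayward.
Variables (R : realType) (m b : R).

Definition hB (r : R) : R := 2 * b ^+ 2 * m + r ^+ 2 * (r - 2 * m).
Definition hB1 (r : R) : R := 2 * b ^+ 2 * m + r ^+ 3.
Definition hB2 (r : R) : R := 4 * b ^+ 2 * m - r ^+ 3.

(* A point is the row vector (t, r, theta, phi). *)
Definition r_coord (x : 'rV[R]_4) : R := x 0 (@Ordinal 4 1 isT).
Definition theta_coord (x : 'rV[R]_4) : R := x 0 (@Ordinal 4 2 isT).

Definition hayward_domain : set 'rV[R]_4 :=
  [set x | [/\ 0 < r_coord x, 0 < theta_coord x < pi & hB (r_coord x) != 0]].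

Definition hayward (x : 'rV[R]_4) : 'M[R]_4 :=
  let r := r_coord x in
  diag_mx (\row_(i < 4) [:: - (hB r / hB1 r); hB1 r / hB r;
                            r ^+ 2; r ^+ 2 * sin (theta_coord x) ^+ 2]`_i).

End Hayward.

(* Main.v *)
(* A static metric -f dt^2 + dr^2/f + r^2 dOmega^2 splits as g = g1 + g2 along the
   (t,r) and (theta,phi) planes, and its curvature tensor is a combination
   k1/2 g1^g1 + k2 g1^g2 + k3/2 g2^g2 of Kulkarni-Nomizu products, with
   k1 = f''/2, k2 = f'/(2r), k3 = (f-1)/r^2; the Ricci tensor is s1 g1 + s2 g2 and
   the Weyl tensor has the shape of R, with k1 = k3 = -2 k2.  For two tensors T, H
   of this shape T.H = k2(T) Q(g,H), because (T.H)_{...nu mu} is k_{mu nu}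
   Q(g,H)_{...nu mu} and Q(g,H) vanishes when nu, mu lie in the same plane.
   Polarizing Q(A, A^A) = 0, every Q(s1 g1 + s2 g2, H) is a combination of the two
   independent tensors Q(g1, g1^g2) and Q(g2, g1^g2), so each identity reduces to
   two equations between rational functions of r.  R.R and Q(S,R) are proportional
   only where k2 (k3 - k1) (k2^2 - k1 k3) = 0, which excludes the Ricci generalized
   case. *)
Require Import Defs.
From mathcomp Require Import all_boot all_order all_algebra.
From mathcomp Require Import all_classical all_reals all_analysis.
From mathcomp Require Import ring lra.

Set Implicit Arguments.
Unset Strict Implicit.
Unset Printing Implicit Defensive.

Import Order.TTheory GRing.Theory Num.Theory.
Import numFieldNormedType.Exports.
Local Open Scope ring_scope.

(** * Pointwise algebra of Kulkarni-Nomizu products, [tdot] and [tachibana] *)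

Section Tensors.
Variables (R : realType) (n : nat).
Implicit Types A U Z g : 'M[R]_n.

Lemma tuple4P (q : 4.-tuple 'I_n) : exists a b c d, q = [tuple a; b; c; d].
Proof.
by case/tupleP: q => a q; case/tupleP: q => b q; case/tupleP: q => c q;
   case/tupleP: q => d q; exists a, b, c, d; apply: val_inj; rewrite [q]tuple0.
Qed.

Lemma tuple6P (q : (4 + 2).-tuple 'I_n) :
  exists a b c d nu mu, q = [tuple a; b; c; d; nu; mu].
Proof.
by case/tupleP: q => a q; case/tupleP: q => b q; case/tupleP: q => c q;
   case/tupleP: q => d q; case/tupleP: q => nu q; case/tupleP: q => mu q;
   exists a, b, c, d, nu, mu; apply: val_inj; rewrite [q]tuple0.
Qed.

Lemma tensor4E (F : 'I_n -> 'I_n -> 'I_n -> 'I_n -> R) (a b c d : 'I_n) :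
  tensor4 F [tuple a; b; c; d] = F a b c d.
Proof. by []. Qed.

Lemma tachibana4E Z (H : tensor R n 4) (a b c d nu mu : 'I_n) :
  tachibana Z H [tuple a; b; c; d; nu; mu] =
    Z mu a * H [tuple nu; b; c; d] + Z mu b * H [tuple a; nu; c; d]
    + Z mu c * H [tuple a; b; nu; d] + Z mu d * H [tuple a; b; c; nu]
    - (Z nu a * H [tuple mu; b; c; d] + Z nu b * H [tuple a; mu; c; d]
    + Z nu c * H [tuple a; b; mu; d] + Z nu d * H [tuple a; b; c; mu]).
Proof.
rewrite /tachibana /tensorD2 !big_ord_recr !big_ord0 /= !add0r !tnth_mktuple.
congr (_ * H _ + _ * H _ + _ * H _ + _ * H _
       - (_ * H _ + _ * H _ + _ * H _ + _ * H _)).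
all: by apply: eq_from_tnth => j; rewrite !tnth_mktuple; case: j => -[|[|[|[|?]]]].
Qed.

Lemma eq_tachibana Z (H H' : tensor R n 4) q :
  H =1 H' -> tachibana Z H q = tachibana Z H' q.
Proof.
by have [a [b [c [d [nu [mu ->]]]]]] := tuple6P q => HH'; rewrite !tachibana4E !HH'.
Qed.

Lemma eq_tdot g (T T' H H' : tensor R n 4) q :
  T =1 T' -> H =1 H' -> tdot g T H q = tdot g T' H' q.
Proof.
move=> TT' HH'; rewrite /tdot /tensorD2; congr (- _).
by apply: eq_bigr => p _; apply: eq_bigr => r _; congr (_ * _);
   apply: eq_bigr => i _; rewrite TT' HH'.
Qed.

(* A tensor whose only nonzero components, in an orthogonal frame, are the
   sectional ones: minus [k p q] is the sectional curvature of the plane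
   (p, q), by the sign convention chosen for the curvature. *)
Definition sectional (k : 'I_n -> 'I_n -> R) g : tensor R n 4 :=
  tensor4 (fun p q mu nu => k p q * (g p nu * g q mu - g p mu * g q nu)).

(** In T.H the first two slots of T carry mu and nu, so the factor [k mu nu] leaves the contraction.
    What remains is contracted with the inverse metric to Kronecker deltas, which put mu or nu into
    slot i of H: exactly the terms of Q(g,H). *)
Lemma tdot_sectional (k : 'I_n -> 'I_n -> R) g (H : tensor R n 4) (a b c d nu mu : 'I_n) :
  g^T = g -> g \in unitmx ->
  let q := [tuple a; b; c; d; nu; mu] in
  tdot g (sectional k g) H q = k mu nu * tachibana g H q.
Proof.
move=> gT gU q.
have gE i j : g i j = g j i by rewrite -{1}gT mxE.
have gV p m : \sum_r invmx g p r * g m r = (p == m)%:R.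
  transitivity ((invmx g *m g) p m); last by rewrite mulVmx // mxE.
  by rewrite mxE; apply: eq_bigr => r _; rewrite [g m r]gE.
rewrite /tdot /tachibana /tensorD2.
rewrite (_ : tnth q (rshift 4 ord0) = nu) // (_ : tnth q (rshift 4 ord_max) = mu) //.
set s := [tuple tnth q (lshift 2 i) | i < 4].
have step p i : \sum_r invmx g p r * (sectional k g [tuple mu; nu; tnth s i; r]
    * H (subst_index s i p)) = k mu nu * (g nu (tnth s i) *
    ((p == mu)%:R * H (subst_index s i p)) - g mu (tnth s i) *
    ((p == nu)%:R * H (subst_index s i p))).
  rewrite -!gV !mulr_suml !mulr_sumr -sumrB mulr_sumr.
  by apply: eq_bigr => r _; rewrite /sectional /tensor4 /=; ring.
have pick i m : \sum_p (p == m)%:R * H (subst_index s i p) = H (subst_index s i m).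
  rewrite (bigD1 m) //= eqxx mul1r big1 ?addr0 // => p /negbTE ->.
  by rewrite mul0r.
under eq_bigr do [under eq_bigr do rewrite mulr_sumr; rewrite exchange_big].
rewrite exchange_big -sumrN /= mulrBr !mulr_sumr -sumrB.
apply: eq_bigr => i _; under eq_bigr do rewrite step.
by rewrite -mulr_sumr sumrB -!mulr_sumr !pick; ring.
Qed.

(** This is the part linear in t of Q(A + tU, (A + tU)^(A + tU)) = 0. *)
Lemma tachibana_kn_symm A U q : A^T = A -> U^T = U ->
  tachibana U (kulkarni_nomizu A A) q = - 2 * tachibana A (kulkarni_nomizu A U) q.
Proof.
have [a [b [c [d [nu [mu ->]]]]]] := tuple6P q => AT UT.
have AE i j : A i j = A j i by rewrite -{1}AT mxE.
have UE i j : U i j = U j i by rewrite -{1}UT mxE.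
rewrite !tachibana4E /kulkarni_nomizu !tensor4E.
(* Symmetric entries are brought to one fixed order of indices, so that [ring] sees equal atoms. *)
rewrite ?(AE c a) ?(AE d a) ?(AE c b) ?(AE d b).
rewrite ?(AE nu a) ?(AE nu b) ?(AE nu c) ?(AE nu d).
rewrite ?(AE mu a) ?(AE mu b) ?(AE mu c) ?(AE mu d) ?(AE mu nu).
rewrite ?(UE c a) ?(UE d a) ?(UE c b) ?(UE d b).
rewrite ?(UE nu a) ?(UE nu b) ?(UE nu c) ?(UE nu d).
rewrite ?(UE mu a) ?(UE mu b) ?(UE mu c) ?(UE mu d) ?(UE mu nu).
ring.
Qed.

(** Taking U = A above makes the tensor equal to -2 times itself. *)
Lemma tachibana_kn_diag A q : A^T = A -> tachibana A (kulkarni_nomizu A A) q = 0.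
Proof. by move=> AT; have := tachibana_kn_symm q AT AT; lra. Qed.

Lemma kulkarni_nomizuC A U : kulkarni_nomizu A U =1 kulkarni_nomizu U A.
Proof.
move=> q; have [a [b [c [d ->]]]] := tuple4P q.
by rewrite /kulkarni_nomizu !tensor4E; ring.
Qed.

(** * Tensors adapted to a splitting of the metric into two orthogonal blocks *)

Section TwoBlocks.
Variables (e : pred 'I_n) (g : 'M[R]_n).
Hypotheses (gT : g^T = g) (ge : forall i j, e i != e j -> g i j = 0).

(** Testing the row index is enough: by [ge] the metric has no entries across the blocks. *)
Definition block1 : 'M[R]_n := \matrix_(i, j) if e i then g i j else 0.
Definition block2 : 'M[R]_n := \matrix_(i, j) if e i then 0 else g i j.
Definition block_sum (s1 s2 : R) : 'M[R]_n := s1 *: block1 + s2 *: block2.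

Definition block_curv (k1 k2 k3 : R) : tensor R n 4 :=
  sectional (fun i j => if e i then (if e j then k1 else k2)
                        else if e j then k2 else k3) g.

Let gE i j : g i j = g j i. Proof. by rewrite -{1}gT mxE. Qed.

Lemma block1T : block1^T = block1.
Proof.
apply/matrixP => i j; rewrite !mxE gE.
by case: ifP (@ge i j); case: ifP => //= _ _ ->.
Qed.

Lemma block2T : block2^T = block2.
Proof.
apply/matrixP => i j; rewrite !mxE gE.
by case: ifP (@ge i j); case: ifP => //= _ _ ->.
Qed.

Lemma block_sum1 : block_sum 1 1 = g.
Proof.
by apply/matrixP => i j; rewrite !mxE; case: ifP => _; ring.
Qed.

(** A product of two metric entries survives only if mu, nu lie in the blocks of p, q in some order,
    so the coefficients depend on the blocks of p and q alone. *)
Lemma kn_block_sum (a b c d : R) :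
  kulkarni_nomizu (block_sum a b) (block_sum c d)
  =1 block_curv (2 * a * c) (a * d + b * c) (2 * b * d).
Proof.
move=> q; have [p [r [m [s ->]]]] := tuple4P q.
rewrite /block_curv /sectional /kulkarni_nomizu !tensor4E !mxE.
have := (@ge p m, @ge p s, @ge r m, @ge r s).
by case: (e p); case: (e r); case: (e m); case: (e s) => /= -[[[g1 g2] g3] g4];
  try rewrite (g1 isT); try rewrite (g2 isT); try rewrite (g3 isT);
  try rewrite (g4 isT); ring.
Qed.

Lemma block_curvE (k1 k2 k3 : R) q : block_curv k1 k2 k3 q =
  k1 / 2 * kulkarni_nomizu block1 block1 q
  + k2 * kulkarni_nomizu block1 block2 q
  + k3 / 2 * kulkarni_nomizu block2 block2 q.
Proof.
have E1 : block1 = block_sum 1 0 by rewrite /block_sum scale1r scale0r addr0.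
have E2 : block2 = block_sum 0 1 by rewrite /block_sum scale1r scale0r add0r.
rewrite [in RHS]E1 [in RHS]E2 !kn_block_sum.
have [a [b [c [d ->]]]] := tuple4P q.
rewrite /block_curv /sectional !tensor4E.
by case: (e a); case: (e b); field.
Qed.

(** [base1] and [base2] span all the tensors Q(Z,H) with Z a [block_sum] and H a [block_curv]. *)
Definition base1 := tachibana block1 (kulkarni_nomizu block1 block2).
Definition base2 := tachibana block2 (kulkarni_nomizu block1 block2).

Lemma tachibana_block s1 s2 k1 k2 k3 q :
  tachibana (block_sum s1 s2) (block_curv k1 k2 k3) q =
  (k2 * s1 - k1 * s2) * base1 q + (k2 * s2 - k3 * s1) * base2 q.
Proof.
have AT := block1T; have UT := block2T.
have Q11 := tachibana_kn_diag q AT; have Q22 := tachibana_kn_diag q UT.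
(* Of the six tensors in the bilinear expansion, two vanish, two are -2 [base1] and -2 [base2], and
   two are [base1] and [base2] themselves. *)
have Q12 := tachibana_kn_symm q AT UT; have Q21 := tachibana_kn_symm q UT AT.
rewrite (eq_tachibana _ _ (kulkarni_nomizuC block2 block1)) in Q21.
have -> : tachibana (block_sum s1 s2) (block_curv k1 k2 k3) q =
   k1 / 2 * (s1 * tachibana block1 (kulkarni_nomizu block1 block1) q
          + s2 * tachibana block2 (kulkarni_nomizu block1 block1) q)
 + k2 * (s1 * base1 q + s2 * base2 q)
 + k3 / 2 * (s1 * tachibana block1 (kulkarni_nomizu block2 block2) q
          + s2 * tachibana block2 (kulkarni_nomizu block2 block2) q).
  rewrite (eq_tachibana _ _ (block_curvE k1 k2 k3)) /base1 /base2.
  have [a [b [c [d [nu [mu ->]]]]]] := tuple6P q.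
  have sE i j : block_sum s1 s2 i j = s1 * block1 i j + s2 * block2 i j.
    by rewrite !mxE.
  by rewrite !tachibana4E !sE; ring.
by rewrite Q11 Q12 Q21 Q22 /base1 /base2; field.
Qed.

(** With nu and mu in one block, Q(Z,.) for the other block Z is zero term by term. For Z the same
    block it is the derivation by an endomorphism that is skew for that block and zero on the other
    one, hence it kills their Kulkarni-Nomizu product. *)
Lemma base_same_block (a b c d nu mu : 'I_n) :
  e nu = e mu -> let q := [tuple a; b; c; d; nu; mu] in
  base1 q = 0 /\ base2 q = 0.
Proof.
move=> enm; rewrite /= /base1 /base2 !tachibana4E /kulkarni_nomizu !tensor4E.
have AE i j : block1 i j = block1 j i by rewrite -{1}block1T mxE.
have UE i j : block2 i j = block2 j i by rewrite -{1}block2T mxE.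
rewrite !(AE _ nu) !(UE _ nu) !(AE _ mu) !(UE _ mu).
case enu: (e nu).
  have U1 j : block2 nu j = 0 by rewrite mxE enu.
  have U2 j : block2 mu j = 0 by rewrite mxE -enm enu.
  rewrite ?(AE c a) ?(AE d a) ?(AE c b) ?(AE d b).
  rewrite ?(UE c a) ?(UE d a) ?(UE c b) ?(UE d b).
  by rewrite !U1 !U2; split; ring.
have U1 j : block1 nu j = 0 by rewrite mxE enu.
have U2 j : block1 mu j = 0 by rewrite mxE -enm enu.
rewrite ?(AE c a) ?(AE d a) ?(AE c b) ?(AE d b).
rewrite ?(UE c a) ?(UE d a) ?(UE c b) ?(UE d b).
by rewrite !U1 !U2; split; ring.
Qed.

Lemma tdot_block k1 k2 k3 l1 l2 l3 q : g \in unitmx ->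
  tdot g (block_curv k1 k2 k3) (block_curv l1 l2 l3) q =
  k2 * tachibana g (block_curv l1 l2 l3) q.
Proof.
move=> gU; have [a [b [c [d [nu [mu ->]]]]]] := tuple6P q.
rewrite tdot_sectional // -[X in tachibana X]block_sum1 tachibana_block.
(* For nu and mu in one block both sides vanish, whatever the factor; across the blocks the factor
   is [k2]. *)
case enm: (e nu == e mu).
  have [-> ->] := base_same_block a b c d (eqP enm).
  by rewrite !mulr0 addr0 !mulr0.
by case: (e mu) (e nu) enm => -[].
Qed.

End TwoBlocks.
End Tensors.

(** * Partial derivatives of functions of a single coordinate *)

Section CoordinateDerivatives.
Variables (R : realType) (n : nat).

(** Along direction i the difference quotient is that of u when i = j and identically zero
    otherwise. *)
Lemma is_derive_coord (u : R -> R) (du : R) (i j : 'I_n) (x : 'rV[R]_n) :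
  is_derive (x 0 j) 1 u du ->
  is_derive x (delta_mx 0 i) (fun y => u (y 0 j)) ((i == j)%:R * du).
Proof.
case: (eqVneq i j) => [-> [du_ex du_val]|ij _]; last first.
  rewrite mul0r.
  have E : (fun h : R => h^-1 *: (((fun y : 'rV[R]_n => u (y 0 j)) \o shift x)
      (h *: delta_mx 0 i) - u (x 0 j))) = cst 0.
    apply/funext => h /=; rewrite !mxE /= eq_sym (negbTE ij) mulr0 add0r.
    by rewrite subrr scaler0.
  by split; rewrite /derivable /derive ?E; [exact: is_cvg_cst|exact: lim_cst].
rewrite mul1r.
have E : (fun h : R => h^-1 *: (((fun y : 'rV[R]_n => u (y 0 j)) \o shift x)
     (h *: delta_mx 0 j) - u (x 0 j))) =
   (fun h : R => h^-1 *: ((u \o shift (x 0 j)) (h *: 1) - u (x 0 j))).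
  by apply/funext => h /=; rewrite !mxE !eqxx.
by split; [move: du_ex; rewrite /derivable E|rewrite -du_val /derive E].
Qed.

End CoordinateDerivatives.

(** * Christoffel symbols and curvature of a static spherically symmetric metric *)

Section StaticMetric.
Variables (R : realType) (f f1 f2 : R -> R).
Hypothesis fD : forall r : R, 0 < r -> is_derive r 1 f (f1 r).
Hypothesis f1D : forall r : R, 0 < r -> is_derive r 1 f1 (f2 r).

Local Notation rc := (@r_coord R).
Local Notation thc := (@theta_coord R).

Definition static_metric (x : 'rV[R]_4) : 'M[R]_4 :=
  diag_mx (\row_(i < 4) [:: - f (rc x); (f (rc x))^-1;
                            rc x ^+ 2; rc x ^+ 2 * sin (thc x) ^+ 2]`_i).

Definition static_domain (x : 'rV[R]_4) : Prop :=
  [/\ 0 < rc x, 0 < thc x < pi & f (rc x) != 0].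

(** Each diagonal entry is a function of r times a function of theta. The tables are indexed by
    [nat] so that case analysis on an index computes. *)
Definition metric_r (i : nat) (r : R) : R :=
  match i with 0 => - f r | 1 => (f r)^-1 | _ => r ^+ 2 end.
Definition metric_r' (i : nat) (r : R) : R :=
  match i with 0 => - f1 r | 1 => - f1 r / f r ^+ 2 | _ => 2 * r end.
Definition metric_th (i : nat) (th : R) : R :=
  match i with 3 => sin th ^+ 2 | _ => 1 end.
Definition metric_th' (i : nat) (th : R) : R :=
  match i with 3 => 2 * sin th * cos th | _ => 0 end.

(** The Christoffel symbols factor in the same way. The default is 0 here and 1 in [gamma_th], so
    that this factor decides which symbols vanish. *)
Definition gamma_r (a q nu : nat) (r : R) : R :=
  match a, q, nu with
  | 0, 0, 1 | 0, 1, 0 => f1 r / (2 * f r)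
  | 1, 0, 0 => f r * f1 r / 2
  | 1, 1, 1 => - (f1 r / (2 * f r))
  | 1, 2, 2 | 1, 3, 3 => - (r * f r)
  | 2, 1, 2 | 2, 2, 1 | 3, 1, 3 | 3, 3, 1 => r^-1
  | 2, 3, 3 | 3, 2, 3 | 3, 3, 2 => 1
  | _, _, _ => 0
  end.
Definition gamma_r' (a q nu : nat) (r : R) : R :=
  match a, q, nu with
  | 0, 0, 1 | 0, 1, 0 => (f2 r * f r - f1 r ^+ 2) / (2 * f r ^+ 2)
  | 1, 0, 0 => (f1 r ^+ 2 + f r * f2 r) / 2
  | 1, 1, 1 => - ((f2 r * f r - f1 r ^+ 2) / (2 * f r ^+ 2))
  | 1, 2, 2 | 1, 3, 3 => - (f r + r * f1 r)
  | 2, 1, 2 | 2, 2, 1 | 3, 1, 3 | 3, 3, 1 => - r ^- 2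
  | _, _, _ => 0
  end.
Definition gamma_th (a q nu : nat) (th : R) : R :=
  match a, q, nu with
  | 1, 3, 3 => sin th ^+ 2
  | 2, 3, 3 => - (sin th * cos th)
  | 3, 2, 3 | 3, 3, 2 => cos th / sin th
  | _, _, _ => 1
  end.
(** With the derivative of the cotangent written as -1 - cot^2, the curvature components simplify by
    field operations alone, without the Pythagorean identity. *)
Definition gamma_th' (a q nu : nat) (th : R) : R :=
  match a, q, nu with
  | 1, 3, 3 => 2 * sin th * cos th
  | 2, 3, 3 => sin th ^+ 2 - cos th ^+ 2
  | 3, 2, 3 | 3, 3, 2 => - 1 - (cos th / sin th) ^+ 2
  | _, _, _ => 0
  end.

Lemma is_derive_metric_r i (r : R) : 0 < r -> f r != 0 ->
  is_derive r 1 (metric_r i) (metric_r' i r).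
Proof.
move=> r0 fr0; have Df := fD r0.
case: i => [|[|i]] /=.
- by apply: is_deriveN.
- apply: is_derive_eq; first exact: is_deriveV.
  by rewrite /GRing.scale /= mulrC mulrN mulNr.
- apply: is_derive_eq; rewrite /GRing.scale /=; ring.
Qed.

Lemma is_derive_metric_th i (th : R) : is_derive th 1 (metric_th i) (metric_th' i th).
Proof.
case: i => [|[|[|[|i]]]] /=; try exact: is_derive_cst.
apply: is_derive_eq; rewrite /GRing.scale /=; ring.
Qed.

Lemma is_derive_gamma_r a q nu (r : R) : 0 < r -> f r != 0 ->
  is_derive r 1 (gamma_r a q nu) (gamma_r' a q nu r).
Proof.
move=> r0 fr0; have Df := fD r0; have Df1 := f1D r0.
have r_neq0 : r != 0 by rewrite gt_eqF.
have D0 (c : R) : is_derive r 1 (fun=> c) 0 by exact: is_derive_cst.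
have Dinv : is_derive r 1 (fun s : R => s^-1) (- r ^- 2).
  apply: is_derive_eq; first by apply: (@is_deriveV _ id).
  by rewrite /GRing.scale /= mulr1.
have Dq : is_derive r 1 (fun s => f1 s / (2 * f s))
    ((f2 r * f r - f1 r ^+ 2) / (2 * f r ^+ 2)).
  have D2 : is_derive r 1 (fun s => (2 * f s)^-1) (- f1 r / (2 * f r ^+ 2)).
    apply: is_derive_eq.
      apply: (@is_deriveV _ (fun s => 2 * f s)).
      by rewrite mulf_neq0.
    rewrite /GRing.scale /=; field; exact/fr0.
  apply: is_derive_eq; rewrite /GRing.scale /=; field; exact/fr0.
move: a q nu => [|[|[|[|a]]]] [|[|[|[|q]]]] [|[|[|[|nu]]]] /=; rewrite /gamma_r /=.
all: try exact: D0.
all: try exact: Dq.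
all: try exact: Dinv.
- apply: is_derive_eq; rewrite /GRing.scale /=; ring.
- exact: is_deriveN.
- by apply: is_derive_eq; rewrite /GRing.scale /=; ring.
- by apply: is_derive_eq; rewrite /GRing.scale /=; ring.
Qed.

Lemma is_derive_gamma_th a q nu (th : R) : sin th != 0 ->
  is_derive th 1 (gamma_th a q nu) (gamma_th' a q nu th).
Proof.
move=> s0.
have D0 (c : R) : is_derive th 1 (fun=> c) 0 by exact: is_derive_cst.
have Dcot : is_derive th 1 (fun t => cos t / sin t) (- 1 - (cos th / sin th) ^+ 2).
  have D2 : is_derive th 1 (fun t => (sin t)^-1) (- sin th ^- 2 * cos th).
    exact: is_deriveV.
  by apply: is_derive_eq; rewrite /GRing.scale /=; field.
move: a q nu => [|[|[|[|a]]]] [|[|[|[|q]]]] [|[|[|[|nu]]]] /=; rewrite /gamma_th /=.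
all: try exact: D0.
all: try exact: Dcot.
- by apply: is_derive_eq; rewrite /GRing.scale /=; ring.
- by apply: is_derive_eq; rewrite /GRing.scale /=; ring.
Qed.

Lemma partial_sep (u v : R -> R) (du dv : R) (i : 'I_4) (x : 'rV[R]_4) :
  is_derive (rc x) 1 u du -> is_derive (thc x) 1 v dv ->
  partial i (fun y => u (rc y) * v (thc y)) x =
    (nat_of_ord i == 1)%:R * du * v (thc x) + (nat_of_ord i == 2)%:R * u (rc x) * dv.
Proof.
move=> Du Dv; rewrite /partial.
have Du' := is_derive_coord i Du; have Dv' := is_derive_coord i Dv.
have [_ ->] := is_deriveM Du' Dv'.
rewrite /GRing.scale /= -!val_eqE /= -/(rc x) -/(thc x); ring.
Qed.

Lemma static_domain_sin x : static_domain x -> sin (thc x) != 0.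
Proof. by case=> _ /andP[th0 thpi] _; rewrite gt_eqF // sin_gt0_pi // th0. Qed.

Lemma static_metricE x (a b : 'I_4) :
  static_metric x a b = (a == b)%:R * (metric_r a (rc x) * metric_th a (thc x)).
Proof.
rewrite !mxE; case: eqP => _; rewrite ?mulr0n ?mul0r // mulr1n mul1r.
by case: a => -[|[|[|[|a]]]] //= _; rewrite ?mulr1.
Qed.

Lemma static_metric_sum x (a : 'I_4) (F : 'I_4 -> R) :
  \sum_b static_metric x a b * F b = metric_r a (rc x) * metric_th a (thc x) * F a.
Proof.
rewrite (bigD1 a) //= big1 ?addr0 => [|b ba]; rewrite static_metricE.
  by rewrite eqxx mul1r.
by rewrite eq_sym (negbTE ba) !mul0r.
Qed.

Lemma metric_neq0 x (a : 'I_4) : static_domain x ->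
  metric_r a (rc x) * metric_th a (thc x) != 0.
Proof.
move=> Dx; have s0 := static_domain_sin Dx; have [r0 _ f0] := Dx.
have r_neq0 : rc x != 0 by rewrite gt_eqF.
by case: a => -[|[|[|[|a]]]] //= _; rewrite ?mulr1 ?oppr_eq0 ?invr_eq0 ?mulf_neq0 ?expf_neq0.
Qed.

Lemma static_metricT x : (static_metric x)^T = static_metric x.
Proof. exact: tr_diag_mx. Qed.

Lemma static_metricV x : static_domain x -> static_metric x *m
  (\matrix_(a, b) ((a == b)%:R / (metric_r a (rc x) * metric_th a (thc x)))) = 1%:M.
Proof.
move=> Dx; apply/matrixP => a b; rewrite !mxE (bigD1 a) //= big1 => [|c ca].
  rewrite static_metricE eqxx !mxE mul1r addr0 mulrCA mulfV ?mulr1 //.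
  exact: metric_neq0.
by rewrite static_metricE eq_sym (negbTE ca) !mul0r.
Qed.

Lemma static_metric_unit x : static_domain x -> static_metric x \in unitmx.
Proof. by move/static_metricV/mulmx1_unit => []. Qed.

Lemma invmx_static x (a b : 'I_4) : static_domain x ->
  invmx (static_metric x) a b =
  (a == b)%:R / (metric_r a (rc x) * metric_th a (thc x)).
Proof.
move=> Dx; have gU := static_metric_unit Dx.
rewrite -[invmx _]mulmx1 -(static_metricV Dx) mulmxA mulVmx // mul1mx.
by rewrite mxE.
Qed.

Lemma partial_static i a b x : static_domain x ->
  partial i (fun y => static_metric y a b) x = (a == b)%:R *
   ((nat_of_ord i == 1)%:R * metric_r' a (rc x) * metric_th a (thc x)
   + (nat_of_ord i == 2)%:R * metric_r a (rc x) * metric_th' a (thc x)).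
Proof.
move=> [r0 _ f0]; under [X in partial i X]funext do rewrite static_metricE.
case: eqP => _; last first.
  by under [X in partial i X]funext do rewrite mul0r; rewrite mul0r /partial derive_cst.
under [X in partial i X]funext do rewrite mul1r.
rewrite mul1r; apply: partial_sep; first exact: is_derive_metric_r.
exact: is_derive_metric_th.
Qed.

Lemma christoffel_static a q nu x : static_domain x ->
  christoffel static_metric a q nu x =
  gamma_r a q nu (rc x) * gamma_th a q nu (thc x).
Proof.
(* The inverse metric is diagonal, so only e = a contributes. *)
move=> Dx; rewrite /christoffel (bigD1 a) //= big1 => [|c ca]; last first.
  by rewrite invmx_static // eq_sym (negbTE ca) !mul0r.
rewrite addr0 invmx_static // eqxx !partial_static //.
have s0 := static_domain_sin Dx; have [r0 _ f0] := Dx.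
have r_neq0 : rc x != 0 by rewrite gt_eqF.
case: a q nu => -[|[|[|[|a]]]] // ha [] [|[|[|[|q]]]] // hq [] [|[|[|[|nu]]]] // hnu.
all: rewrite -!val_eqE /gamma_r /gamma_th /metric_r /metric_r' /metric_th /metric_th' /=.
all: rewrite ?mul0r ?addr0 ?mulr0 ?subr0 ?oppr0 ?mulr0 //.
all: field.
all: rewrite ?f0 ?s0 ?r_neq0 //.
Qed.


(** The closed form of the Christoffel symbols holds only on the domain; openness allows it to be
    differentiated. *)
Lemma near_static_domain x : static_domain x -> \forall y \near x, static_domain y.
Proof.
move=> [r0 /andP[th0 thpi] f0].
have rC : {for x, continuous rc} by exact: coord_continuous.
have thC : {for x, continuous thc} by exact: coord_continuous.
have fC : {for rc x, continuous f}.
  have [fd _] := fD r0.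
  exact/differentiable_continuous/derivable1_diffP.
have frC : {for x, continuous (f \o rc)} by exact: continuous_comp.
near=> y; split.
- near: y; exact: (cvgr_gt _ rC).
- apply/andP; split; near: y; first exact: (cvgr_gt _ thC).
  exact: (cvgr_lt _ thC).
- near: y; exact: (cvgr_neq0 _ frC f0).
Unshelve. all: by end_near. Qed.

Lemma partial_christoffel i a q nu x : static_domain x ->
  partial i (christoffel static_metric a q nu) x =
  (nat_of_ord i == 1)%:R * gamma_r' a q nu (rc x) * gamma_th a q nu (thc x)
   + (nat_of_ord i == 2)%:R * gamma_r a q nu (rc x) * gamma_th' a q nu (thc x).
Proof.
move=> Dx; have s0 := static_domain_sin Dx; have [r0 _ f0] := Dx.
rewrite -(partial_sep i (is_derive_gamma_r _ _ _ r0 f0) (is_derive_gamma_th _ _ _ s0)).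
apply: near_eq_derive; have := near_static_domain Dx.
by apply: filterS => y Dy; exact: christoffel_static.
Qed.

Definition first_block : pred 'I_4 := fun i => (i < 2)%N.

Lemma riemann_static x : static_domain x ->
  riemann static_metric x =1
  block_curv first_block (static_metric x) (f2 (rc x) / 2)
    (f1 (rc x) / (2 * rc x)) ((f (rc x) - 1) / rc x ^+ 2).
Proof.
move=> Dx k; have [p [q [mu [nu ->]]]] := tuple4P k.
(* Both sides are antisymmetric in mu and nu, which leaves six pairs to compute. *)
wlog mu_nu : mu nu / (mu < nu)%N => [H|].
  case: (ltngtP mu nu) => [||/val_inj ->]; first exact: H.
    move/H/(congr1 -%R); rewrite /riemann /block_curv /sectional !tensor4E.
    rewrite -mulrN opprB => <-; rewrite -sumrN; apply: eq_bigr => a _.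
    rewrite -mulrN !opprD opprK -sumrN [- _ + _]addrC.
    by congr (_ * (_ + _)); apply: eq_bigr => c _; rewrite opprB.
  rewrite /riemann /block_curv /sectional !tensor4E !subrr !mulr0.
  by apply: big1 => a _; rewrite subrr add0r big1 ?mulr0 // => c _; rewrite subrr.
have s0 := static_domain_sin Dx; have [r0 _ f0] := Dx.
have r_neq0 : rc x != 0 by rewrite gt_eqF.
rewrite /riemann /block_curv /sectional !tensor4E.
rewrite static_metric_sum !partial_christoffel // !static_metricE.
rewrite !big_ord_recr big_ord0 /= !christoffel_static //=.
set r := rc x in r_neq0 f0 *; set th := thc x in s0 *.
rewrite -!val_eqE /first_block /=.
case: mu nu mu_nu => -[|[|[|[|mu]]]] // hmu [] [|[|[|[|nu]]]] // hnu _.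
all: case: p q => -[|[|[|[|p]]]] // hp [] [|[|[|[|q]]]] // hq.
all: rewrite /gamma_r /gamma_r' /gamma_th /gamma_th' /metric_r /metric_th /=.
all: rewrite ?(mul0r, mulr0) ?(addr0, add0r, oppr0) ?(mul0r, mulr0) ?subrr ?mulr0 //.
all: by field; rewrite ?f0 ?s0 ?r_neq0.
Qed.

End StaticMetric.

(** * Ricci, scalar and Weyl curvature of a block curvature tensor in dimension four *)

Section BlockCurvature.
Variables (R : realType) (f f1 f2 : R -> R) (x : 'rV[R]_4).
Hypothesis Dx : static_domain f x.
Variables k1 k2 k3 : R.
Variable g : 'rV[R]_4 -> 'M[R]_4.
Hypothesis gx : g x = static_metric f x.
Hypothesis curv : riemann g x =1 block_curv first_block (g x) k1 k2 k3.

Local Notation s1 := (k1 + 2 * k2).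
Local Notation s2 := (k3 + 2 * k2).

Lemma static_metric_block i j : first_block i != first_block j ->
  static_metric f x i j = 0.
Proof.
by rewrite static_metricE; case: (i =P j) => [->|]; rewrite ?eqxx ?mul0r.
Qed.

(** A direction shares its block with one other direction and faces two in the other block; summing
    the coefficients of these three planes gives [s1] or [s2]. *)
Lemma ricci_block : ricci g x = block_sum first_block (g x) s1 s2.
Proof.
apply/matrixP => q mu; rewrite mxE /block_sum !mxE.
have E p nu : invmx (g x) p nu * riemann g x [tuple p; q; mu; nu] =
  invmx (g x) p nu * block_curv first_block (g x) k1 k2 k3 [tuple p; q; mu; nu].
  by rewrite curv.
under eq_bigr do under eq_bigr do rewrite E.
have S p : \sum_nu invmx (g x) p nu *
    block_curv first_block (g x) k1 k2 k3 [tuple p; q; mu; nu] =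
  (if first_block p then (if first_block q then k1 else k2)
   else if first_block q then k2 else k3) *
  ((p != q)%:R * g x q mu).
  rewrite (bigD1 p) //= big1 ?addr0 => [|c cp]; last first.
    by rewrite gx invmx_static // eq_sym (negbTE cp) !mul0r.
  rewrite /block_curv /sectional !tensor4E gx invmx_static // eqxx !static_metricE.
  rewrite eqxx; have := metric_neq0 p Dx; set m := _ * _ => m0.
  case: (eqVneq p q) => [<-|pq]; rewrite ?(eq_sym q p) ?(negbTE pq).
    by rewrite -/m; case: (p =P mu) => _; rewrite /=; field.
  by rewrite /= mul0r mulr0 subr0; field.
under eq_bigr do rewrite S.
rewrite !big_ord_recr big_ord0 /=.
case: q {E S} => -[|[|[|[|q]]]] // hq; rewrite -!val_eqE /first_block /=; ring.
Qed.

Lemma scalar_curvature_block : scalar_curvature g x = 2 * (s1 + s2).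
Proof.
rewrite /scalar_curvature.
have S q : \sum_mu invmx (g x) q mu * ricci g x q mu =
  if first_block q then s1 else s2.
  rewrite (bigD1 q) //= big1 ?addr0 => [|c cq]; last first.
    by rewrite gx invmx_static // eq_sym (negbTE cq) !mul0r.
  rewrite ricci_block /block_sum !mxE gx invmx_static // static_metricE eqxx.
  have := metric_neq0 q Dx; set m := _ * _ => m0.
  by case: ifP => _; rewrite /=; field.
under eq_bigr do rewrite S.
by rewrite !big_ord_recr big_ord0 /first_block /=; ring.
Qed.

(** The Weyl tensor is trace-free, so both of its Ricci coefficients, k1 + 2 k2 and k3 + 2 k2, are
    zero; a single scalar w remains. *)
Lemma weyl_block : weyl g x =1
  let w := (2 * k2 - k1 - k3) / 6 in
  block_curv first_block (g x) (- 2 * w) w (- 2 * w).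
Proof.
move=> q /=; rewrite /weyl scalar_curvature_block ricci_block curv.
have gT : (g x)^T = g x by rewrite gx static_metricT.
have ge i j : first_block i != first_block j -> g x i j = 0.
  by rewrite gx; exact: static_metric_block.
have := kn_block_sum ge; rewrite /= => kn.
(* Writing g as [block_sum] 1 1 brings g^S and g^g under [kn_block_sum]. *)
rewrite -[X in kulkarni_nomizu X (block_sum _ _ _ _) q](block_sum1 first_block).
rewrite kn.
rewrite -[X in kulkarni_nomizu X X q](block_sum1 first_block) kn.
have [a [b [c [d ->]]]] := tuple4P q.
rewrite /block_curv /sectional !tensor4E.
by case: (first_block a); case: (first_block b); field.
Qed.
End BlockCurvature.

(** * Smoothness of rational functions of one coordinate *)

Section RationalSmooth.
Variables (R : realType) (n : nat).
Local Open Scope classical_set_scope.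

Lemma Ck_on_subset (U V : set 'rV[R]_n) k (h : 'rV[R]_n -> R) :
  V `<=` U -> Ck_on k U h -> Ck_on k V h.
Proof.
move=> VU; elim: k h => [|k IH] h [hC hD]; split=> //; try by move=> x /VU /hC.
by move=> i; have [hd hk] := hD i; split; [move=> x /VU /hd|exact: IH].
Qed.

Lemma is_derive_ratio (p q : {poly R}) (r : R) : q.[r] != 0 ->
  is_derive r 1 (fun s => p.[s] / q.[s])
    ((p^`() * q - p * q^`()).[r] / (q ^+ 2).[r]).
Proof.
move=> qr0; have qD : is_derive r 1 (fun s => q.[s]^-1) (- q.[r] ^- 2 * q^`().[r]).
  exact: is_deriveV.
by apply: is_derive_eq; rewrite /GRing.scale /= hornerD hornerN !hornerM; field.
Qed.

Lemma continuous_ratio (U : set 'rV[R]_n) (j : 'I_n) (p q : {poly R})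
    (h : 'rV[R]_n -> R) :
  open U -> (forall x, U x -> q.[x 0 j] != 0) ->
  (forall x, U x -> h x = p.[x 0 j] / q.[x 0 j]) ->
  forall x, U x -> {for x, continuous h}.
Proof.
move=> oU q0 hE x Ux; rewrite /prop_for /continuous_at hE //.
apply: (@cvg_trans _ ((fun y : 'rV[R]_n => p.[y 0 j] / q.[y 0 j]) @ x)).
  apply: (@near_eq_cvg _ _ (nbhs x)).
  by move: (open_nbhs_nbhs (conj oU Ux)); apply: filterS => y /hE.
apply: (@continuous_comp _ _ _ (fun y : 'rV[R]_n => y 0 j)
          (fun r => p.[r] / q.[r])).
  exact: coord_continuous.
have [Dx _] := is_derive_ratio p (q0 x Ux).
exact/differentiable_continuous/derivable1_diffP.
Qed.

(** Quotients of polynomials in one coordinate are closed under partial derivatives: the denominator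
    becomes q^2 and still does not vanish. The induction therefore runs over all p, q and h. *)
Lemma Ck_on_rational (U : set 'rV[R]_n) (j : 'I_n) k (p q : {poly R})
    (h : 'rV[R]_n -> R) :
  open U -> (forall x, U x -> q.[x 0 j] != 0) ->
  (forall x, U x -> h x = p.[x 0 j] / q.[x 0 j]) -> Ck_on k U h.
Proof.
move=> oU; elim: k p q h => [|k IH] p q h q0 hE.
  by split=> //; exact: continuous_ratio oU q0 hE.
split=> [|i]; first exact: continuous_ratio oU q0 hE.
pose d := (i == j)%:R *: (p^`() * q - p * q^`()).
have hD x : U x -> is_derive x (delta_mx 0 i) h (d.[x 0 j] / (q ^+ 2).[x 0 j]).
  move=> Ux; rewrite hornerZ -mulrA.
  apply: near_eq_is_derive (is_derive_coord i (is_derive_ratio p (q0 x Ux))).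
  by move: (open_nbhs_nbhs (conj oU Ux)); apply: filterS => y /hE.
split; first by move=> x /hD [].
apply: (IH d (q ^+ 2)) => x Ux; first by rewrite horner_exp expf_neq0 // q0.
by have [_ hd] := hD x Ux.
Qed.

End RationalSmooth.

(** * Curvature coefficients of the Hayward metric *)

Section HaywardCurvature.
Variables (R : realType) (m b : R).
Hypotheses (m_gt0 : 0 < m) (b_gt0 : 0 < b).

Local Notation B := (hB m b).
Local Notation B1 := (hB1 m b).
Local Notation B2 := (hB2 m b).

(** For f = B/B1 = 1 - 2 m r^2/B1, these three are f''/2, f'/(2r) and (f - 1)/r^2. *)
Definition hayward_k1 (r : R) : R :=
  - 2 * m * (4 * b ^+ 4 * m ^+ 2 - 14 * b ^+ 2 * m * r ^+ 3 + r ^+ 6) / B1 r ^+ 3.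
Definition hayward_k2 (r : R) : R := - (m * B2 r / B1 r ^+ 2).
Definition hayward_k3 (r : R) : R := - 2 * m / B1 r.

Lemma hB1_gt0 r : 0 < r -> 0 < B1 r.
Proof.
by move=> r0; rewrite /hB1 addr_gt0 // ?exprn_gt0 // !mulr_gt0 // exprn_gt0.
Qed.

Let h (r : R) := B r / B1 r.
Let h1 (r : R) := 2 * r * hayward_k2 r.
Let h2 (r : R) := 2 * hayward_k1 r.

Lemma hayward_static : hayward m b = static_metric h.
Proof.
apply/funext => x; rewrite /hayward /static_metric; congr diag_mx.
by apply/rowP => i; rewrite !mxE /h invf_div.
Qed.

Lemma hayward_static_domain x : hayward_domain m b x -> static_domain h x.
Proof.
move=> [r0 th0 Bx]; split=> //.
by rewrite /h mulf_neq0 // invr_eq0 gt_eqF // hB1_gt0.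
Qed.

Lemma is_derive_invB1 (r : R) : 0 < r ->
  is_derive r 1 (fun s => (B1 s)^-1) (- 3 * r ^+ 2 / B1 r ^+ 2).
Proof.
move=> r0; have B10 : B1 r != 0 by rewrite gt_eqF // hB1_gt0.
have D : is_derive r 1 B1 (3 * r ^+ 2).
  by rewrite /hB1; apply: is_derive_eq; rewrite /GRing.scale /=; ring.
by apply: is_derive_eq; rewrite /GRing.scale /=; field.
Qed.

Lemma is_derive_hayward (r : R) : 0 < r -> is_derive r 1 h (h1 r).
Proof.
move=> r0; have D := is_derive_invB1 r0.
have B10 : B1 r != 0 by rewrite gt_eqF // hB1_gt0.
have DB : is_derive r 1 B (3 * r ^+ 2 - 4 * m * r).
  by rewrite /hB; apply: is_derive_eq; rewrite /GRing.scale /=; ring.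
rewrite /h; apply: is_derive_eq; rewrite /GRing.scale /= /h1 /hayward_k2.
by move: B10; rewrite /hB /hB1 /hB2 => B10; field.
Qed.

Lemma is_derive_hayward' (r : R) : 0 < r -> is_derive r 1 h1 (h2 r).
Proof.
move=> r0; have D := is_derive_invB1 r0.
have B10 : B1 r != 0 by rewrite gt_eqF // hB1_gt0.
have DB : is_derive r 1 B2 (- 3 * r ^+ 2).
  by rewrite /hB2; apply: is_derive_eq; rewrite /GRing.scale /=; ring.
(* In this form [h1] is a product of functions whose derivatives are at hand in [D] and [DB]. *)
have -> : h1 = (fun s => - 2 * m * s * B2 s * (B1 s)^-1 ^+ 2).
  by apply/funext => s; rewrite /h1 /hayward_k2 exprVn; ring.
apply: is_derive_eq; rewrite /GRing.scale /= /h2 /hayward_k1.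
by move: B10; rewrite /hB1 /hB2 => B10; field.
Qed.

Lemma riemann_hayward x : hayward_domain m b x ->
  let r := r_coord x in
  riemann (hayward m b) x =1
  block_curv first_block (hayward m b x) (hayward_k1 r) (hayward_k2 r) (hayward_k3 r).
Proof.
move=> Mx r; have [r0 _ B0] := Mx.
have B10 : B1 r != 0 by rewrite gt_eqF // hB1_gt0.
have r_neq0 : r != 0 by rewrite gt_eqF.
have := riemann_static is_derive_hayward is_derive_hayward' (hayward_static_domain Mx).
rewrite -hayward_static -/r => curv q; rewrite curv.
congr (block_curv _ _ _ _ _ _); first by rewrite /h2; field.
  by rewrite /h1; field.
rewrite /h /hayward_k3; move: B10; rewrite /hB /hB1 => B10; field.
by rewrite B10.
Qed.

Lemma weyl_hayward x : hayward_domain m b x ->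
  let r := r_coord x in
  let w := - (m * r ^+ 3 * B2 r / B1 r ^+ 3) in
  weyl (hayward m b) x =1
  block_curv first_block (hayward m b x) (- 2 * w) w (- 2 * w).
Proof.
move=> Mx r w q; have [r0 _ B0] := Mx.
have B10 : B1 r != 0 by rewrite gt_eqF // hB1_gt0.
have gx : hayward m b x = static_metric h x by rewrite hayward_static.
rewrite (weyl_block (hayward_static_domain Mx) gx (riemann_hayward Mx)).
have -> // : (2 * hayward_k2 r - hayward_k1 r - hayward_k3 r) / 6 = w.
rewrite /w /hayward_k1 /hayward_k2 /hayward_k3.
by move: B10; rewrite /hB1 /hB2 => B10; field.
Qed.

Lemma ricci_hayward x : hayward_domain m b x ->
  let r := r_coord x in
  ricci (hayward m b) x = block_sum first_block (hayward m b x)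
    (hayward_k1 r + 2 * hayward_k2 r) (hayward_k3 r + 2 * hayward_k2 r).
Proof.
move=> Mx; have gx : hayward m b x = static_metric h x by rewrite hayward_static.
by move=> r; rewrite (ricci_block (hayward_static_domain Mx) gx (riemann_hayward Mx)).
Qed.

End HaywardCurvature.

(** * Block formulas at a point of the Hayward spacetime *)

Section HaywardTensors.
Variables (R : realType) (m b : R).
Hypotheses (m_gt0 : 0 < m) (b_gt0 : 0 < b).
Variable x : 'rV[R]_4.
Hypothesis Mx : hayward_domain m b x.

Local Notation g := (hayward m b x).
Local Notation r := (r_coord x).
Local Notation base1 := (base1 first_block g).
Local Notation base2 := (base2 first_block g).

Lemma haywardT : g^T = g. Proof. exact: tr_diag_mx. Qed.

Lemma hayward_unit : g \in unitmx.
Proof.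
rewrite hayward_static; apply: static_metric_unit.
exact: hayward_static_domain.
Qed.

Lemma hayward_block i j : first_block i != first_block j -> g i j = 0.
Proof.
rewrite hayward_static; apply: static_metric_block.
Qed.

Lemma tdot_hayward (T H : tensor R 4 4) k1 k2 k3 l1 l2 l3 q :
  T =1 block_curv first_block g k1 k2 k3 ->
  H =1 block_curv first_block g l1 l2 l3 ->
  tdot g T H q = k2 * tachibana g H q.
Proof.
move=> TE HE; rewrite (eq_tdot _ _ TE HE) (eq_tachibana _ _ HE).
exact: tdot_block haywardT hayward_block _ _ _ _ _ _ _ hayward_unit.
Qed.

Lemma tachibana_hayward s1 s2 (H : tensor R 4 4) l1 l2 l3 q :
  H =1 block_curv first_block g l1 l2 l3 ->
  tachibana (block_sum first_block g s1 s2) H q =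
  (l2 * s1 - l1 * s2) * base1 q + (l2 * s2 - l3 * s1) * base2 q.
Proof.
move=> HE; rewrite (eq_tachibana _ _ HE).
exact: tachibana_block haywardT hayward_block _ _ _ _ _ _.
Qed.

Lemma tachibana_metric_hayward (H : tensor R 4 4) l1 l2 l3 q :
  H =1 block_curv first_block g l1 l2 l3 ->
  tachibana g H q = (l2 - l1) * base1 q + (l2 - l3) * base2 q.
Proof.
move=> HE; rewrite -[X in tachibana X](block_sum1 first_block).
by rewrite (tachibana_hayward _ _ _ HE) !mulr1.
Qed.

(* Three indices in one block and one in the other, contracted across the
   blocks, isolate each of the two tensors. *)
Lemma bases_independent : exists q1 q2,
  [/\ base1 q1 != 0, base2 q1 = 0, base1 q2 = 0 & base2 q2 != 0].
Proof.
pose i0 : 'I_4 := Ordinal (isT : 0 < 4)%N; pose i1 : 'I_4 := Ordinal (isT : 1 < 4)%N.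
pose i2 : 'I_4 := Ordinal (isT : 2 < 4)%N; pose i3 : 'I_4 := Ordinal (isT : 3 < 4)%N.
exists [tuple i0; i1; i1; i2; i2; i0], [tuple i2; i3; i3; i0; i0; i2].
have off i j : i != j -> g i j = 0.
  by move=> ij; rewrite !mxE (negbTE ij).
have diag i : g i i != 0.
  rewrite hayward_static static_metricE eqxx mul1r metric_neq0 //.
  exact: hayward_static_domain.
have b1 i j : block1 first_block g i j = if first_block i then g i j else 0.
  by rewrite mxE.
have b2 i j : block2 first_block g i j = if first_block i then 0 else g i j.
  by rewrite mxE.
rewrite /base1 /base2 !tachibana4E /kulkarni_nomizu !tensor4E !b1 !b2 /first_block /=.
rewrite (off i0 i1) // (off i1 i0) // (off i0 i2) // (off i2 i0) // (off i1 i2) //.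
rewrite (off i2 i1) // (off i2 i3) // (off i3 i2) // (off i0 i3) // (off i3 i0) //.
rewrite !(mul0r, mulr0, addr0, subr0, add0r); by split; rewrite ?oppr0 ?mulf_neq0.
Qed.
End HaywardTensors.

(** * Failure of the Ricci generalized condition, and smoothness of the pseudosymmetry function *)

Section HaywardDomain.
Variables (R : realType) (m b : R).
Hypotheses (m_gt0 : 0 < m) (b_gt0 : 0 < b).

(* For [r >= 2m] the function B is positive; [r^3 > 16 b^2 m] avoids the radii
   [r^3 = 4 b^2 m], where R . R = 0, and [r^3 = 16 b^2 m], where R . R = Q(S, R). *)
Definition far_point : 'rV[R]_4 :=
  \row_(i < 4) [:: 0; 2 * m + 4 * b; pi / 2; 0]`_i.

Lemma far_point_domain : hayward_domain m b far_point.
Proof.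
have pi0 := pi_gt0 R.
rewrite /hayward_domain /far_point /r_coord /theta_coord /= !mxE /=; split.
- by rewrite addr_gt0 // mulr_gt0.
- by apply/andP; split; lra.
- rewrite gt_eqF // /hB.
  have -> : 2 * b ^+ 2 * m + (2 * m + 4 * b) ^+ 2 * (2 * m + 4 * b - 2 * m) =
    2 * b ^+ 2 * m + (2 * m + 4 * b) ^+ 2 * (4 * b) by ring.
  by rewrite !(addr_gt0, mulr_gt0, exprn_gt0).
Qed.

Lemma far_point_radius : 16 * b ^+ 2 * m < r_coord far_point ^+ 3.
Proof.
rewrite /r_coord mxE /= -subr_gt0.
have -> : (2 * m + 4 * b) ^+ 3 - 16 * b ^+ 2 * m =
  8 * m ^+ 3 + 48 * m ^+ 2 * b + 80 * m * b ^+ 2 + 64 * b ^+ 3 by ring.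
by rewrite !addr_gt0 // !mulr_gt0 // ?exprn_gt0.
Qed.

Lemma not_ricci_generalized_hayward :
  ~ ricci_generalized_pseudosymmetric (hayward_domain m b) (hayward m b).
Proof.
set x := far_point; have Mx := far_point_domain; rewrite -/x in Mx.
move=> [L _ HL]; set r := r_coord x in Mx *.
have r_big : 16 * b ^+ 2 * m < r ^+ 3 by exact: far_point_radius.
have [r0 _ _] := Mx; have B10 : hB1 m b r != 0 by rewrite gt_eqF // hB1_gt0.
have RE := riemann_hayward m_gt0 b_gt0 Mx; rewrite /= -/r in RE.
have SE := ricci_hayward m_gt0 b_gt0 Mx; rewrite /= -/r in SE.
have [q1 [q2 [b11 b21 b12 b22]]] := bases_independent m_gt0 b_gt0 Mx.
have RR q := tdot_hayward m_gt0 b_gt0 Mx q RE RE.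
have QgR q := tachibana_metric_hayward q RE.
set k1 := hayward_k1 m b r in RE SE RR QgR.
set k2 := hayward_k2 m b r in RE SE RR QgR.
set k3 := hayward_k3 m b r in RE SE RR QgR.
have QSR q := tachibana_hayward (k1 + 2 * k2) (k3 + 2 * k2) q RE.
(* [c1] and [c2] are the coordinates of Q(S,R) in [base1] and [base2]; those of Q(g,R) are k2 - k1
   and k2 - k3. *)
pose c1 := k2 * (k1 + 2 * k2) - k1 * (k3 + 2 * k2).
pose c2 := k2 * (k3 + 2 * k2) - k3 * (k1 + 2 * k2).
have Vx q : tachibana (ricci (hayward m b) x) (riemann (hayward m b) x) q != 0 ->
    forall q', k2 * tachibana (hayward m b x) (riemann (hayward m b) x) q' =
    L x * tachibana (ricci (hayward m b) x) (riemann (hayward m b) x) q'.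
  by move=> Qq q'; rewrite -RR; apply: HL; split => //; exists q.
have k2_neq0 : k2 != 0.
  have B20 : hB2 m b r < 0.
    rewrite /hB2 subr_lt0; apply: lt_trans r_big.
    by rewrite !ltr_pM2r ?exprn_gt0 // ltr_nat.
  rewrite /k2 /hayward_k2 oppr_eq0 mulf_neq0 ?invr_eq0 ?expf_neq0 //.
  by rewrite mulf_neq0 ?(lt_eqF B20) ?(gt_eqF m_gt0).
(* The determinant of the two coordinate pairs is (k3 - k1)(k2^2 - k1 k3); where it is nonzero,
   Q(g,R) and Q(S,R) are not proportional. *)
have det_neq0 : (k2 - k1) * c2 - (k2 - k3) * c1 != 0.
  have -> : (k2 - k1) * c2 - (k2 - k3) * c1 =
      108 * m ^+ 4 * b ^+ 2 * r ^+ 6 * (r ^+ 3 - 16 * b ^+ 2 * m) / hB1 m b r ^+ 7.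
    rewrite /c1 /c2 /k1 /k2 /k3 /hayward_k1 /hayward_k2 /hayward_k3.
    by move: B10; rewrite /hB1 /hB2 => B10; field.
  have d_gt0 : 0 < r ^+ 3 - 16 * b ^+ 2 * m by rewrite subr_gt0.
  rewrite mulf_neq0 ?invr_eq0 ?expf_neq0 // mulf_neq0 ?gt_eqF //.
  by rewrite !mulr_gt0 ?exprn_gt0.
(* The hypothesis on L applies only where Q(S,R) is nonzero. Since the determinant is nonzero, [c1]
   or [c2] is, and [q1] or [q2] detects it. *)
have prop : forall q', k2 * tachibana (hayward m b x) (riemann (hayward m b) x) q' =
    L x * tachibana (ricci (hayward m b) x) (riemann (hayward m b) x) q'.
  have [c10|c1n] := eqVneq c1 0; last first.
    by apply: (Vx q1); rewrite SE QSR -/c1 -/c2 b21 mulr0 addr0 mulf_neq0.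
  have [c20|c2n] := eqVneq c2 0; last first.
    by apply: (Vx q2); rewrite SE QSR -/c1 -/c2 b12 mulr0 add0r mulf_neq0.
  by move: det_neq0; rewrite c10 c20 !mulr0 subrr eqxx.
have E1 : k2 * (k2 - k1) = L x * c1.
  apply: (mulIf b11); have := prop q1.
  by rewrite SE QSR QgR -/c1 -/c2 b21 !mulr0 !addr0 !mulrA.
have E2 : k2 * (k2 - k3) = L x * c2.
  apply: (mulIf b22); have := prop q2.
  by rewrite SE QSR QgR -/c1 -/c2 b12 !mulr0 !add0r !mulrA.
(* By [E1] and [E2] the left side becomes L c1 c2 - L c2 c1. *)
have : k2 * ((k2 - k1) * c2 - (k2 - k3) * c1) = 0.
  by rewrite mulrBr !mulrA E1 E2; ring.
by apply/eqP; rewrite mulf_neq0.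
Qed.

Local Open Scope classical_set_scope.

Lemma smooth_hayward (V : set 'rV[R]_4) : V `<=` hayward_domain m b ->
  smooth_on V (fun x => - (m * hB2 m b (r_coord x) / hB1 m b (r_coord x) ^+ 2)).
Proof.
(* Smoothness is proved on the larger half-space r > 0, which is open and where B1 is positive, then
   restricted. *)
move=> VM k; pose U := [set x : 'rV[R]_4 | 0 < r_coord x].
apply: (@Ck_on_subset _ _ U) => [x /VM[]//|].
pose P1 : {poly R} := (2 * b ^+ 2 * m)%:P + 'X ^+ 3.
pose P2 : {poly R} := (- m)%:P * ((4 * b ^+ 2 * m)%:P - 'X ^+ 3).
have P1E s : P1.[s] = hB1 m b s by rewrite /P1 hornerD hornerC hornerXn.
apply: (@Ck_on_rational _ _ U (Ordinal (isT : 1 < 4)%N) k P2 (P1 ^+ 2)).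
- rewrite openE => x Ux; have rC : {for x, continuous (@r_coord R)}.
    exact: coord_continuous.
  exact: (cvgr_gt _ rC).
- by move=> x Ux; rewrite horner_exp P1E expf_neq0 // gt_eqF // hB1_gt0.
- move=> x Ux; rewrite horner_exp P1E /P2 hornerM hornerC hornerD hornerN hornerC.
  by rewrite hornerXn !mulNr.
Qed.

End HaywardDomain.

Theorem proposition3p4 (R : realType) (m b : R) (m_gt0 : 0 < m) (b_gt0 : 0 < b) :
  let M := hayward_domain m b in
  let g := hayward m b in
  let Rm := riemann g in
  let S := ricci g in
  let C := weyl g in
  ~ ricci_generalized_pseudosymmetric M g /\
  pseudosymmetric M g /\
  forall x, M x ->
  let r := r_coord x in
  let B1 := hB1 m b r in
  let B2 := hB2 m b r in
  (* (i) *)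
  (forall q, tdot (g x) (Rm x) (Rm x) q
     = - (m * B2 / B1 ^+ 2) * tachibana (g x) (Rm x) q) /\
  (forall q, tdot (g x) (Rm x) (C x) q
     = - (m * B2 / B1 ^+ 2) * tachibana (g x) (C x) q) /\
  (* (ii) *)
  (forall q, tdot (g x) (C x) (Rm x) q
     = - (m * r ^+ 3 * B2 / B1 ^+ 3) * tachibana (g x) (Rm x) q) /\
  (forall q, tdot (g x) (C x) (C x) q
     = - (m * r ^+ 3 * B2 / B1 ^+ 3) * tachibana (g x) (C x) q) /\
  (* (iii) *)
  (B2 != 0 -> forall q,
     tdot (g x) (Rm x) (Rm x) q
     - m * (16 * b ^+ 2 * m - r ^+ 3) / (B2 * B1) * tachibana (g x) (C x) q
     = tachibana (S x) (Rm x) q) /\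
  (* (iv) *)
  (r ^+ 3 != 16 * b ^+ 2 * m ->
     let L1 := - (8 * b ^+ 2 * m ^+ 2 * B2
                  / ((16 * b ^+ 2 * m - r ^+ 3) * B1 ^+ 2)) in
     let L2 := (16 * b ^+ 4 * m ^+ 2 - 8 * b ^+ 2 * m * r ^+ 3 + r ^+ 6)
               / ((r ^+ 3 - 16 * b ^+ 2 * m) * B1) in
     forall q, tdot (g x) (C x) (Rm x) q - tdot (g x) (Rm x) (C x) q
       = L1 * tachibana (g x) (Rm x) q + L2 * tachibana (S x) (Rm x) q) /\
  (* (v) *)
  (let L3 := 8 * b ^+ 2 * m ^+ 2 * B2 / B1 ^+ 3 in
   let L4 := 1 in
   forall q, tdot (g x) (C x) (Rm x) q - tdot (g x) (Rm x) (C x) q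
     = L3 * tachibana (g x) (C x) q + L4 * tachibana (S x) (C x) q).
Proof.
move=> M g Rm S C; split; first exact: not_ricci_generalized_hayward.
have RR x (Mx : M x) q :=
  tdot_hayward m_gt0 b_gt0 Mx q (riemann_hayward m_gt0 b_gt0 Mx) (riemann_hayward m_gt0 b_gt0 Mx).
split.
  exists (fun x => - (m * hB2 m b (r_coord x) / hB1 m b (r_coord x) ^+ 2)).
    by apply: smooth_hayward => // x [].
  by move=> x [Mx _] q; exact: RR.
move=> x Mx r B1 B2; have [r0 _ _] := Mx.
have B10 : B1 != 0 by rewrite gt_eqF // hB1_gt0.
have RE := riemann_hayward m_gt0 b_gt0 Mx; have CE := weyl_hayward m_gt0 b_gt0 Mx.
have SE := ricci_hayward m_gt0 b_gt0 Mx.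
rewrite /= in RE CE SE.
have RC q := tdot_hayward m_gt0 b_gt0 Mx q RE CE.
have CR q := tdot_hayward m_gt0 b_gt0 Mx q CE RE.
have CC q := tdot_hayward m_gt0 b_gt0 Mx q CE CE.
have QgR q := tachibana_metric_hayward q RE.
have QgC q := tachibana_metric_hayward q CE.
have QSR s1 s2 q := tachibana_hayward s1 s2 q RE.
have QSC s1 s2 q := tachibana_hayward s1 s2 q CE.
rewrite /Rm /S /C /g.
(* In (i) and (ii) the factor is the mixed coefficient of the left operand, R or C, whatever the
   right one. *)
do 4 (split; first by move=> q; rewrite ?RR ?RC ?CR ?CC).
split=> [B20 q|].
  (* Both sides are now combinations of [base1 q] and [base2 q], which [field] treats as atoms while
     comparing the rational coefficients. *)
  rewrite RR // SE QSR QgR QgC /hayward_k1 /hayward_k2 /hayward_k3.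
  move: B10 B20; rewrite /B1 /B2 /hB1 /hB2 -/r => B10 B20; field.
  by rewrite B10 B20.
split=> [r3 q|q].
  rewrite CR RC SE QSR QgR QgC /B1 /B2 /hayward_k1 /hayward_k2 /hayward_k3.
  move: B10; rewrite /B1 /B2 /hB1 /hB2 -/r => B10; field.
  (* The two denominators of (iv) contain r^3 - 16 b^2 m with opposite signs, hence two nonvanishing
     conditions. *)
  by rewrite B10 subr_eq0 r3 subr_eq0 eq_sym r3.
rewrite CR RC SE QSC QgR QgC /B1 /B2 /hayward_k1 /hayward_k2 /hayward_k3.
by move: B10; rewrite /B1 /B2 /hB1 /hB2 -/r => B10; field.
Qed.
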